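(* Let $u$ be a quasi-definite moment functional on $\Pi^d$, let $\xi_1,\dots,\xi_N$ be distinct points of $\mathbb{R}^d$, let $\lambda_1,\dots,\lambda_N$ be nonzero real numbers, $\Lambda=\operatorname{diag}\{\lambda_1,\dots,\lambda_N\}$, and let $v$ be the moment functional $\langle v,p\rangle=\langle u,p\rangle+\lambda_1p(\xi_1)+\cdots+\lambda_Np(\xi_N)$, $p\in\Pi^d$. (a) Assume that $v$ is quasi-definite. Then the matrices $I_N+\Lambda\mathcal{K}_{n-1}$ are invertible for $n=1,2,\dots$, and any polynomial system $\{\mathbb{Q}_n\}_{n\ge0}$ orthogonal with respect to $v$ can be written in the form $$\mathbb{Q}_0(\mathbf{x})=\mathbb{P}_0(\mathbf{x}),\qquad \mathbb{Q}_n(\mathbf{x})=\mathbb{P}_n(\mathbf{x})-\mathsf{P}_n(\xi)\,(I_N+\Lambda\mathcal{K}_{n-1})^{-1}\Lambda\,\mathsf{K}_{n-1}(\xi,\mathbf{x}),\quad n\ge1,\qquad ( * )$$ where $\{\mathbb{P}_n\}_{n\ge0}$ is a polynomial system orthogonal with respect to $u$. Moreover, the invertible matrices $\hat H_n=\langle v,\mathbb{Q}_n\mathbb{Q}_n^t\rangle$ satisfy, for $n\ge 0$, $$\hat H_n=H_n+\mathsf{P}_n(\xi)\,(I_N+\Lambda\mathcal{K}_{n-1})^{-1}\Lambda\,\mathsf{P}_n^t(\xi).\qquad( ** )$$ (b) Conversely, let $\{\mathbb{P}_n\}_{n\ge0}$ be a polynomial system orthogonal with respect to $u$. If the matrices $I_N+\Lambda\mathcal{K}_{n-1}$,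 $n\ge1$, and the matrices given by the right-hand side of $( ** )$, $n\ge0$, are invertible, then the polynomial system $\{\mathbb{Q}_n\}_{n\ge0}$ defined by $( * )$ is an orthogonal polynomial system with respect to $v$, and therefore $v$ is quasi-definite.
   Context: $\Pi^d$ is the space of real polynomials in $d$ variables and $\Pi^d_n$ the subspace of those of total degree at most $n$; $r_n^d=\binom{n+d-1}{n}$ is the number of monomials of total degree $n$. A moment functional is a linear functional $u:\Pi^d\to\mathbb{R}$, $p\mapsto\langle u,p\rangle$; it acts entrywise on matrices of polynomials. A polynomial system (PS) is a sequence $\{\mathbb{P}_n\}_{n\ge0}$ of column vectors, $\mathbb{P}_n$ having $r_n^d$ entries which are polynomials of total degree $n$, such that for every $n$ the entries of $\mathbb{P}_0,\dots,\mathbb{P}_n$ form a basis of $\Pi_n^d$. A PS is orthogonal with respect to $u$ (an OPS) if $\langle u,\mathbb{P}_m\mathbb{P}_n^t\rangle=0$ for $m\ne n$ and $H_n=\langle u,\mathbb{P}_n\mathbb{P}_n^t\rangle$ is invertible for all $n\ge0$ (entries of the same vector need not be mutually orthogonal). $u$ is quasi-definite if an OPS with respect to $u$ exists. The kernels of $u$ are $K_n(u;\mathbf{x},\mathbf{y})=\sum_{m=0}^n\mathbb{P}_m(\mathbf{x})^tH_m^{-1}\mathbb{P}_m(\mathbf{y})$ (independent of the choice of OPS), with $K_{-1}\equiv0$. Notation: $\mathsf{P}_n(\xi)=(\mathbb{P}_n(\xi_1)\,|\,\cdots\,|\,\mathbb{P}_n(\xi_N))$, an $r_n^d\times N$ matrix;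 $\mathcal{K}_n=(K_n(u;\xi_i,\xi_j))_{i,j=1}^N$, an $N\times N$ matrix, with $\mathcal{K}_{-1}=0$; $\mathsf{K}_n(\xi,\mathbf{x})=(K_n(u;\xi_1,\mathbf{x}),\dots,K_n(u;\xi_N,\mathbf{x}))^t$. $\mathsf{P}_n^t(\xi)$ is the transpose of $\mathsf{P}_n(\xi)$. $I_N$ is the identity matrix of size $N$. *)

(* Defs.v *)
From HB Require Import structures.
From mathcomp Require Import all_boot all_order all_algebra.
From mathcomp Require Import reals.
From mathcomp Require Import mpoly.

Set Implicit Arguments.
Unset Strict Implicit.
Unset Printing Implicit Defensive.

Import Order.TTheory GRing.Theory Num.Theory.
Local Open Scope ring_scope.

(* For n + d = 0 the predecessor is truncated; the value is then 'C(0, 0) = 1,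
   the number of monomials of degree 0 in no variables. *)
Definition nmon (d n : nat) : nat := 'C((n + d).-1, n).

Section MomentFunctionals.
Variables (R : realType) (d : nat).

Definition evalmx {m n} (A : 'M[{mpoly R[d]}]_(m, n)) (x : 'rV[R]_d)
    : 'M[R]_(m, n) :=
  map_mx (meval (x 0)) A.

Definition constmx {m n} (A : 'M[R]_(m, n)) : 'M[{mpoly R[d]}]_(m, n) :=
  map_mx (@mpolyC d R) A.

Definition momentmx (u : {scalar {mpoly R[d]}}) {m n}
    (A : 'M[{mpoly R[d]}]_(m, n)) : 'M[R]_(m, n) :=
  map_mx u A.

Definition vecseq : Type := forall n, 'cV[{mpoly R[d]}]_(nmon d n).

Definition lincomb (P : vecseq) (n : nat) (c : forall m, 'cV[R]_(nmon d m))
    : {mpoly R[d]} :=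
  \sum_(m < n.+1) \sum_(i < nmon d m) c m i 0 *: P m i 0.

(* [msize p] is the total degree plus one for p != 0, and [msize 0 = 0]; so
   [msize p = n.+1] is "total degree n" and [(msize p <= n.+1)%N] is
   "total degree at most n". The last two clauses say that the entries of
   P 0, ..., P n are linearly independent and span the polynomials of total
   degree at most n. *)
Definition polynomial_system (P : vecseq) : Prop :=
  [/\ forall n i, msize (P n i 0) = n.+1,
      forall n c, lincomb P n c = 0 -> forall m, (m <= n)%N -> c m = 0
    & forall n p, (msize p <= n.+1)%N -> exists c, p = lincomb P n c].

Definition gram (u : {scalar {mpoly R[d]}}) (P : vecseq) (n : nat)
    : 'M[R]_(nmon d n) :=
  momentmx u (P n *m (P n)^T).

Definition orthogonal_system (u : {scalar {mpoly R[d]}}) (P : vecseq) : Prop :=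
  [/\ polynomial_system P,
      forall m n, m <> n -> momentmx u (P m *m (P n)^T) = 0
    & forall n, gram u P n \in unitmx].

Definition quasi_definite (u : {scalar {mpoly R[d]}}) : Prop :=
  exists P : vecseq, orthogonal_system u P.

(* Kernels are indexed with a shift so that K_{-1} = 0 is included:
   [kernel u P n x] is K_{n-1}(u; x, y), as a polynomial in y. *)
Definition kernel (u : {scalar {mpoly R[d]}}) (P : vecseq) (n : nat)
    (x : 'rV[R]_d) : {mpoly R[d]} :=
  \sum_(m < n)
    (constmx ((evalmx (P m) x)^T *m invmx (gram u P m)) *m P m) 0 0.

Section PointMasses.
Variables (N : nat) (xi : 'I_N -> 'rV[R]_d) (lam : 'rV[R]_N).

Definition add_masses (u : {scalar {mpoly R[d]}}) (p : {mpoly R[d]}) : R :=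
  u p + \sum_(j < N) lam 0 j * p.@[xi j 0].

Lemma add_masses_is_scalar (u : {scalar {mpoly R[d]}}) : scalar (add_masses u).
Proof.
move=> a p q; rewrite /add_masses linearP /= mulrDr addrACA; congr (_ + _).
rewrite mulr_sumr -big_split /=; apply: eq_bigr => j _.
by rewrite mevalD mevalZ mulrDr mulrCA.
Qed.

HB.instance Definition _ (u : {scalar {mpoly R[d]}}) :=
  GRing.isLinear.Build R {mpoly R[d]} R *%R (add_masses u)
    (add_masses_is_scalar u).

Definition points_mx (P : vecseq) (n : nat) : 'M[R]_(nmon d n, N) :=
  \matrix_(i, j) evalmx (P n) (xi j) i 0.

(* As for [kernel], the index n of the next two definitions stands for the
   kernel of index n - 1. *)
Definition kernel_mx (u : {scalar {mpoly R[d]}}) (P : vecseq) (n : nat)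
    : 'M[R]_N :=
  \matrix_(i, j) (kernel u P n (xi i)).@[xi j 0].

Definition kernel_col (u : {scalar {mpoly R[d]}}) (P : vecseq) (n : nat)
    : 'cV[{mpoly R[d]}]_N :=
  \col_i kernel u P n (xi i).

Definition perturbation_mx (u : {scalar {mpoly R[d]}}) (P : vecseq) (n : nat)
    : 'M[R]_N :=
  1%:M + diag_mx lam *m kernel_mx u P n.

Definition modified_system (u : {scalar {mpoly R[d]}}) (P : vecseq) : vecseq :=
  fun n => match n with
  | 0%N => P 0%N
  | k.+1 => P k.+1 -
      constmx (points_mx P k.+1 *m invmx (perturbation_mx u P k.+1)
                 *m diag_mx lam) *m kernel_col u P k.+1
  end.

Definition modified_gram (u : {scalar {mpoly R[d]}}) (P : vecseq) (n : nat)
    : 'M[R]_(nmon d n) :=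
  gram u P n + points_mx P n *m invmx (perturbation_mx u P n)
                 *m diag_mx lam *m (points_mx P n)^T.

End PointMasses.
End MomentFunctionals.

(* Main.v *)
(** The kernel of index n - 1 reproduces, under u, the values of polynomials of
degree less than n. Hence q + sum_j lam_j q(xi_j) K_{n-1}(xi_j, .) has the same
u-moments against polynomials of degree less than n as q has v-moments, and it
differs from q by lower degree terms when deg q = n. So
P_n = Q_n + Q_n(xi) Lambda K_{n-1}(xi, .) exchanges orthogonality for v and for u,
and evaluating this relation at the points xi_j gives
P_n(xi) = Q_n(xi) (I + Lambda K_{n-1}), which can be solved for Q_n. If
c (I + Lambda K_{n-1}) = 0, then q = c Lambda K_{n-1}(xi, .) takes the value -c_j
at xi_j, so v annihilates q p for all p of degree less than n; as v is
quasi-definite, q = 0 and c = 0. *)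
Require Import Defs.
From mathcomp Require Import all_boot all_order all_algebra.
From mathcomp Require Import reals.
From mathcomp Require Import mpoly.

Set Implicit Arguments.
Unset Strict Implicit.
Unset Printing Implicit Defensive.

Import Order.TTheory GRing.Theory Num.Theory.
Local Open Scope ring_scope.

(** * Polynomial systems read through the degree filtration *)

Section PolynomialSystems.
Variables (R : realType) (d : nat).
Implicit Types (p q r : {mpoly R[d]}) (P Q : vecseq R d).

Lemma msizeD_leq p q k :
  (msize p <= k)%N -> (msize q <= k)%N -> (msize (p + q) <= k)%N.
Proof.
by move=> pk qk; rewrite (leq_trans (msizeD_le _ _))// geq_max pk qk.
Qed.

Lemma msize_sum_leq (I : finType) (F : I -> {mpoly R[d]}) k :
  (forall i, (msize (F i) <= k)%N) -> (msize (\sum_i F i) <= k)%N.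
Proof.
move=> Fk; apply: (big_ind (fun p => msize p <= k)%N) => //.
- by rewrite msize0.
- by move=> p q; exact: msizeD_leq.
Qed.

Definition layer P n (c : 'cV[R]_(nmon d n)) : {mpoly R[d]} :=
  \sum_i c i 0 *: P n i 0.

Lemma layerB P n (c e : 'cV[R]_(nmon d n)) :
  layer P (c - e) = layer P c - layer P e.
Proof.
by rewrite /layer -sumrB; apply: eq_bigr => i _; rewrite !mxE scalerBl.
Qed.

Lemma layer0 P n : layer P (0 : 'cV_(nmon d n)) = 0.
Proof. by rewrite /layer big1// => i _; rewrite mxE scale0r. Qed.

(* The form of [polynomial_system] relative to the degree filtration; unlike the
   latter, it visibly depends on [P n] modulo lower degrees only. *)
Definition graded_system P : Prop :=
  [/\ forall n i, msize (P n i 0) = n.+1,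
      forall n (c : 'cV_(nmon d n)), (msize (layer P c) <= n)%N -> c = 0
    & forall n p, (msize p <= n.+1)%N ->
        exists c : 'cV_(nmon d n), (msize (p - layer P c) <= n)%N].

Lemma lincombE P n c : lincomb P n c = \sum_(m < n.+1) layer P (c m).
Proof. by []. Qed.

(** The type of a coefficient vector depends on the degree, so a combination of lower layers
    receives a new top layer by overwriting the family at index [n]. *)
Lemma layers_dfwith P n (c : forall m : nat, 'cV_(nmon d m)) (e : 'cV_(nmon d n)) :
  \sum_(m < n.+1) layer P (dfwith c e m) =
  \sum_(m < n) layer P (c m) + layer P e.
Proof.
rewrite big_ord_recr /= dfwith_in; congr (_ + _).
by apply: eq_bigr => m _; rewrite dfwith_out// gtn_eqF.
Qed.

Lemma msize_layer P n (c : 'cV_(nmon d n)) :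
  (forall i, msize (P n i 0) = n.+1) -> (msize (layer P c) <= n.+1)%N.
Proof.
move=> Pn; apply: msize_sum_leq => i.
by rewrite (leq_trans (msizeZ_le _ _))// Pn.
Qed.

Lemma msize_layers P n (c : forall m, 'cV_(nmon d m)) :
  (forall m i, msize (P m i 0) = m.+1) ->
  (msize (\sum_(m < n) layer P (c m)) <= n)%N.
Proof.
move=> Pn; apply: msize_sum_leq => m.
by rewrite (leq_trans (msize_layer _ (Pn m))).
Qed.

Lemma polynomial_system_layers P n p : polynomial_system P ->
  (msize p <= n)%N ->
  exists c : forall m, 'cV_(nmon d m), p = \sum_(m < n) layer P (c m).
Proof.
case=> _ _ span; case: n => [|n]; last exact: span.
rewrite leqn0 msize_poly_eq0 => /eqP ->.
by exists (fun=> 0); rewrite big_ord0.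
Qed.

Lemma polynomial_system_graded P : polynomial_system P -> graded_system P.
Proof.
move=> PS; have [Psz indep span] := PS; split=> // [n c cn|n p pn].
- have [e ce] := polynomial_system_layers PS cn.
  (* Since [layer P c] equals the combination [e] of lower layers, replacing the coefficient at [n]
     by [- c] gives a vanishing combination. *)
  have := indep n (dfwith e (0 - c)); rewrite lincombE layers_dfwith -ce.
  rewrite layerB layer0 add0r subrr => /(_ erefl n (leqnn n)).
  by rewrite dfwith_in add0r => /eqP; rewrite oppr_eq0 => /eqP.
- have [e ->] := span n p pn; exists (e n).
  by rewrite lincombE big_ord_recr /= addrK msize_layers.
Qed.

Lemma graded_polynomial_system P : graded_system P -> polynomial_system P.
Proof.
move=> [Psz indep span]; split=> // [n c|n p].
- rewrite lincombE => c0 m; rewrite -ltnS => mn.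
  elim: n.+1 c0 m mn => // k IH.
  rewrite big_ord_recr /= => c0.
  (* In a vanishing combination the top layer is minus the sum of the lower ones, hence of too low a
     degree. *)
  have ck : c k = 0.
    apply: indep; rewrite -(addKr (\sum_(m < k) layer P (c m)) (layer P (c k))).
    by rewrite c0 addr0 msizeN msize_layers.
  move: c0; rewrite ck layer0 addr0 => c0 m.
  by rewrite ltnS leq_eqVlt => /predU1P[->//|]; exact: IH.
- rewrite /lincomb; move: n.+1 => {}n; elim: n p => [|n IH] p.
    rewrite leqn0 msize_poly_eq0 => /eqP ->.
    by exists (fun=> 0); rewrite big_ord0.
  move=> /span[c /IH[e pe]]; exists (dfwith e c).
  by rewrite layers_dfwith -pe subrK.
Qed.

(** With equal coefficients, the layers of [P] and [Q] at [n] differ by a polynomial of degree below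
    [n], so each condition of [graded_system] passes from [Q] to [P]. *)
Lemma polynomial_system_perturb P Q : polynomial_system Q ->
  (forall n i, (msize (P n i 0 - Q n i 0)%R <= n)%N) -> polynomial_system P.
Proof.
move=> /polynomial_system_graded[Qsz indep span] PQ.
have layerPQ n (c : 'cV_(nmon d n)) : (msize (layer P c - layer Q c) <= n)%N.
  rewrite /layer -sumrB; apply: msize_sum_leq => i.
  by rewrite -scalerBr (leq_trans (msizeZ_le _ _)).
apply: graded_polynomial_system; split.
- move=> n i; apply/eqP; rewrite eqn_leq ltnNge; apply/andP; split.
    rewrite -(subrK (Q n i 0) (P n i 0)); apply: msizeD_leq; last by rewrite Qsz.
    exact: leqW.
  apply/negP => Pn; suff : (msize (Q n i 0%R) <= n)%N by rewrite Qsz ltnn.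
  rewrite -(subKr (P n i 0) (Q n i 0)).
  by apply: msizeD_leq; rewrite // msizeN.
- move=> n c cn; apply: indep; rewrite -(subKr (layer P c) (layer Q c)).
  by apply: msizeD_leq; rewrite // msizeN.
- move=> n p /span[c pc]; exists c.
  rewrite -(subrKA (layer Q c)); apply: msizeD_leq => //.
  by rewrite -opprB msizeN.
Qed.

(** * Orthogonality to lower degrees and nondegeneracy *)

Implicit Type u : {scalar {mpoly R[d]}}.

Lemma momentmx_mul_tr u m n (A : 'cV_m) (B : 'cV_n) i j :
  momentmx u (A *m B^T) i j = u (A i 0 * B j 0).
Proof. by rewrite !mxE big_ord1 !mxE. Qed.

Lemma layerMr u P n (c : 'cV[R]_(nmon d n)) p :
  u (layer P c * p) = \sum_i c i 0 * u (P n i 0 * p).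
Proof.
rewrite /layer mulr_suml linear_sum /=; apply: eq_bigr => i _.
by rewrite -scalerAl linearZ.
Qed.

Lemma orthogonal_low u P n i p : orthogonal_system u P ->
  (msize p <= n)%N -> u (P n i 0 * p) = 0.
Proof.
case=> PS orth _ /(polynomial_system_layers PS)[c ->].
rewrite mulr_sumr linear_sum big1//= => m _.
rewrite mulrC layerMr big1// => j _.
rewrite -momentmx_mul_tr orth ?mxE ?mulr0// => mn.
by have := ltn_ord m; rewrite mn ltnn.
Qed.

Lemma layer_orthogonal_low u P n (c : 'cV_(nmon d n)) p :
  orthogonal_system u P -> (msize p <= n)%N -> u (layer P c * p) = 0.
Proof.
move=> uP pn; rewrite layerMr big1// => i _.
by rewrite (orthogonal_low _ uP)// mulr0.
Qed.

Lemma layer_moment u P n (c : 'cV_(nmon d n)) j :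
  u (layer P c * P n j 0) = (c^T *m gram u P n) 0 j.
Proof.
by rewrite layerMr [RHS]mxE; apply: eq_bigr => i _; rewrite momentmx_mul_tr mxE.
Qed.

(** Induction on the degree: testing [q] against the entries of the top vector [P n] shows that its
    leading coefficients satisfy [c^T *m gram u P n = 0], so [q] drops in degree. *)
Lemma annihilator_eq0 u P n q : orthogonal_system u P ->
  (msize q <= n)%N -> (forall p, (msize p <= n)%N -> u (q * p) = 0) -> q = 0.
Proof.
move=> uP; have [PS _ Hunit] := uP.
have [Psz _ span] := polynomial_system_graded PS.
elim: n q => [|n IH] q; first by rewrite leqn0 msize_poly_eq0 => /eqP.
move=> /span[c qc] q0.
suff c0 : c = 0.
  by move: qc; rewrite c0 layer0 subr0 => /IH; apply=> p pn; apply/q0/leqW.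
apply: trmx_inj; rewrite trmx0.
apply: (can_inj (mulmxK (Hunit n))); rewrite mul0mx; apply/rowP => j.
rewrite -layer_moment mxE -[layer P c](subKr q) mulrBl linearB /=.
by rewrite q0 ?Psz// mulrC orthogonal_low// subr0.
Qed.

(** The Gram matrices are invertible by nondegeneracy: a row in the left kernel of [gram u P n]
    yields a layer annihilated against all degrees at most [n], which must vanish. *)
Lemma orthogonal_system_of_low u P : quasi_definite u -> polynomial_system P ->
  (forall n i p, (msize p <= n)%N -> u (P n i 0 * p) = 0) ->
  orthogonal_system u P.
Proof.
move=> [P0 uP0] PS low; have [Psz indep span] := polynomial_system_graded PS.
split=> // [m n mn|n].
  apply/matrixP => i j; rewrite momentmx_mul_tr mxE.
  have [lt_mn|lt_nm|//] := ltngtP m n; last by rewrite low ?Psz.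
  by rewrite mulrC low ?Psz.
rewrite -row_free_unit -kermx_eq0; apply/rowV0P => c /sub_kermxP cH.
have lay0 : layer P c^T = 0.
  apply: (annihilator_eq0 uP0 (msize_layer _ (Psz n))) => p /span[e pe].
  rewrite -(subrK (layer P e) p) mulrDr linearD /=.
  rewrite [X in X + _]layerMr big1 ?add0r => [|i _]; last by rewrite low// mulr0.
  rewrite mulrC layerMr big1// => i _.
  by rewrite [P n i 0 * _]mulrC layer_moment trmxK cH mxE mulr0.
by apply: trmx_inj; rewrite trmx0; apply: indep; rewrite lay0 msize0.
Qed.

(** * Kernels and their reproducing property *)

Definition kernel_coef u P n x : 'cV[R]_(nmon d n) :=
  ((evalmx (P n) x)^T *m invmx (gram u P n))^T.

Lemma kernelS u P n x :
  kernel u P n.+1 x = kernel u P n x + layer P (kernel_coef u P n x).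
Proof.
rewrite /kernel big_ord_recr /=; congr (_ + _).
by rewrite [LHS]mxE; apply: eq_bigr => i _; rewrite mxE mul_mpolyC [in RHS]mxE.
Qed.

Lemma kernel0 u P x : kernel u P 0 x = 0.
Proof. by rewrite /kernel big_ord0. Qed.

Lemma msize_kernel u P n x : polynomial_system P ->
  (msize (kernel u P n x) <= n)%N.
Proof.
case=> Psz _ _; elim: n => [|n IH]; first by rewrite kernel0 msize0.
by rewrite kernelS; apply: msizeD_leq; [exact: leqW | exact: msize_layer].
Qed.

(** The bound on [msize p] means degree at most [n - 1], the true index of the shifted kernel. In
    the induction the cross terms vanish by orthogonality, and for the two top layers
    [invmx (gram u P n)] cancels the Gram matrix. *)
Lemma kernel_reproducing u P n x p : orthogonal_system u P ->
  (msize p <= n)%N -> u (kernel u P n x * p) = p.@[x 0].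
Proof.
move=> uP; have [PS _ Hunit] := uP.
have [Psz _ span] := polynomial_system_graded PS.
elim: n p => [|n IH] p.
  by rewrite leqn0 msize_poly_eq0 kernel0 mul0r linear0 => /eqP ->; rewrite meval0.
move=> /span[c]; rewrite -{2 3}(subrK (layer P c) p); move: (p - _) => r rn.
rewrite kernelS mulrDl !mulrDr !linearD /=.
rewrite IH// [kernel u P n x * _]mulrC (layer_orthogonal_low (p := r) _ uP)//.
rewrite (layer_orthogonal_low (p := kernel u P n x) _ uP) ?msize_kernel//.
rewrite addr0 add0r; congr (_ + _).
rewrite [X in u X]mulrC layerMr /layer linear_sum /=; apply: eq_bigr => i _.
rewrite [P n i 0 * _]mulrC layer_moment trmxK mulmxKV// mevalZ; congr (_ * _).
by rewrite !mxE.
Qed.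

Lemma kernel_unique u P Q n x : orthogonal_system u P ->
  orthogonal_system u Q -> kernel u P n x = kernel u Q n x.
Proof.
move=> uP uQ; have [[PS _ _] [QS _ _]] := (uP, uQ).
apply/eqP; rewrite -subr_eq0; apply/eqP; apply: (annihilator_eq0 (n := n) uP).
  by apply: msizeD_leq; rewrite ?msizeN msize_kernel.
by move=> p pn; rewrite mulrBl linearB /= !kernel_reproducing// subrr.
Qed.

End PolynomialSystems.

(** * Point masses and invertibility of the perturbed kernel matrix *)

Section PointMasses.
Variables (R : realType) (d N : nat) (u : {scalar {mpoly R[d]}}).
Variables (xi : 'I_N -> 'rV[R]_d) (lam : 'rV[R]_N).
Implicit Types (p q : {mpoly R[d]}) (P Q : vecseq R d).

Let v : {scalar {mpoly R[d]}} := add_masses xi lam u.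

Lemma add_massesE p : v p = u p + \sum_j lam 0 j * p.@[xi j 0].
Proof. by []. Qed.

Definition kernel_comb P n (c : 'rV[R]_N) : {mpoly R[d]} :=
  \sum_j c 0 j *: kernel u P n (xi j).

Lemma msize_kernel_comb P n c : polynomial_system P ->
  (msize (kernel_comb P n c) <= n)%N.
Proof.
move=> PS; apply: msize_sum_leq => j.
by rewrite (leq_trans (msizeZ_le _ _))// msize_kernel.
Qed.

Lemma kernel_comb_reproducing P n c p : orthogonal_system u P ->
  (msize p <= n)%N -> u (kernel_comb P n c * p) = \sum_j c 0 j * p.@[xi j 0].
Proof.
move=> uP pn; rewrite mulr_suml linear_sum /=; apply: eq_bigr => j _.
by rewrite -scalerAl linearZ /= kernel_reproducing.
Qed.

Lemma meval_kernel_comb P n c j :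
  (kernel_comb P n c).@[xi j 0] = (c *m kernel_mx xi u P n) 0 j.
Proof.
rewrite /kernel_comb linear_sum /= mxE; apply: eq_bigr => i _.
by rewrite mevalZ mxE.
Qed.

Lemma perturbation_mx_unit P n : quasi_definite v -> orthogonal_system u P ->
  perturbation_mx xi lam u P n \in unitmx.
Proof.
move=> [Q vQ] uP; have [PS _ _] := uP.
rewrite -row_free_unit -kermx_eq0; apply/rowV0P => c /sub_kermxP.
rewrite mulmxDr mulmx1 mulmxA.
set cL := c *m diag_mx lam => /eqP; rewrite addr_eq0 => /eqP cE.
(* For [q := kernel_comb P n cL], this makes the mass terms of [v (q * p)] cancel [u (q * p)]. *)
have cLE j : cL 0 j = - (lam 0 j * (kernel_comb P n cL).@[xi j 0]).
  rewrite meval_kernel_comb -[cL *m _]opprK -cE [(- c) _ _]mxE mulrN opprK.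
  by rewrite /cL mul_mx_diag mxE mulrC.
(* By [cE], the entries of [c] are minus the values of this polynomial at the points. *)
suff q0 : kernel_comb P n cL = 0.
  by rewrite cE; apply/rowP => j; rewrite mxE -meval_kernel_comb q0 meval0 oppr0 mxE.
apply: (annihilator_eq0 (n := n) vQ); first exact: msize_kernel_comb.
move=> p pn; rewrite add_massesE kernel_comb_reproducing// -big_split big1//= => j _.
by rewrite mevalM cLE mulrA mulNr addNr.
Qed.

(** * Trading moments of [v] for moments of [u] *)

Definition mass_correction P n p : {mpoly R[d]} :=
  kernel_comb P n (\row_j (lam 0 j * p.@[xi j 0])).

Lemma add_massesM P n q p : orthogonal_system u P -> (msize p <= n)%N ->
  v (q * p) = u ((q + mass_correction P n q) * p).
Proof.
move=> uP pn; rewrite mulrDl linearD /= kernel_comb_reproducing// add_massesE.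
by congr (_ + _); apply: eq_bigr => j _; rewrite mevalM mxE mulrA.
Qed.

Definition eval_points {m} (A : 'cV[{mpoly R[d]}]_m) : 'M[R]_(m, N) :=
  \matrix_(i, j) (A i 0).@[xi j 0].

Lemma points_mxE P n : points_mx xi P n = eval_points (P n).
Proof. by apply/matrixP => i j; rewrite !mxE. Qed.

Lemma eval_pointsD m (A B : 'cV[{mpoly R[d]}]_m) :
  eval_points (A + B) = eval_points A + eval_points B.
Proof. by apply/matrixP => i j; rewrite !mxE mevalD. Qed.

Lemma eval_points_kernel_col P n m (B : 'M[R]_(m, N)) :
  eval_points (constmx d B *m kernel_col xi u P n) = B *m kernel_mx xi u P n.
Proof.
apply/matrixP => i j; rewrite !mxE linear_sum /=; apply: eq_bigr => k _.
by rewrite !mxE mevalM mevalC.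
Qed.

Definition mass_correction_col P n m (A : 'cV[{mpoly R[d]}]_m) :=
  constmx d (eval_points A *m diag_mx lam) *m kernel_col xi u P n.

Lemma mass_correction_colE P n m (A : 'cV[{mpoly R[d]}]_m) i :
  mass_correction_col P n A i 0 = mass_correction P n (A i 0).
Proof.
rewrite mxE; apply: eq_bigr => j _.
by rewrite mul_mx_diag !mxE mul_mpolyC mulrC.
Qed.

Lemma eval_points_mass_correction P n m (A : 'cV[{mpoly R[d]}]_m) :
  eval_points (A + mass_correction_col P n A) =
  eval_points A *m perturbation_mx xi lam u P n.
Proof.
by rewrite eval_pointsD eval_points_kernel_col mulmxDr mulmx1 mulmxA.
Qed.

Lemma kernel_col0 P : kernel_col xi u P 0 = 0.
Proof. by apply/matrixP => i j; rewrite !mxE kernel0. Qed.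

Lemma perturbation_mx0 P : perturbation_mx xi lam u P 0 = 1%:M.
Proof.
rewrite /perturbation_mx (_ : kernel_mx _ _ _ _ = 0) ?mulmx0 ?addr0//.
by apply/matrixP => i j; rewrite !mxE kernel0 meval0.
Qed.

Lemma modified_systemE P n : modified_system xi lam u P n =
  P n - constmx d (points_mx xi P n *m invmx (perturbation_mx xi lam u P n)
                     *m diag_mx lam) *m kernel_col xi u P n.
Proof. by case: n => //=; rewrite kernel_col0 mulmx0 subr0. Qed.

(** The implicit relation on the right involves [A] in the correction only through its values at the
    points; evaluating there determines them, which turns the relation into the explicit formula. *)
Lemma modified_system_fixpoint P n (A : 'cV_(nmon d n)) :
  perturbation_mx xi lam u P n \in unitmx ->
  A = modified_system xi lam u P n <-> P n = A + mass_correction_col P n A.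
Proof.
move=> Munit; rewrite modified_systemE.
set E := points_mx xi P n *m _; split=> [AE|PE].
  have PE : P n = A + constmx d (E *m diag_mx lam) *m kernel_col xi u P n.
    by rewrite AE subrK.
  suff AE' : eval_points A = E by rewrite /mass_correction_col AE'.
  (* After this addition the left side consists of the values of [P n] at the points, and the right
     side is [E] times the perturbation matrix. *)
  apply: (addIr (E *m diag_mx lam *m kernel_mx xi u P n)).
  rewrite -{1}eval_points_kernel_col -eval_pointsD -PE -points_mxE.
  rewrite -[E *m _ *m _]mulmxA -{1}[E]mulmx1 -mulmxDr.
  by rewrite -/(perturbation_mx xi lam u P n) mulmxKV.
by rewrite /E points_mxE {2}PE eval_points_mass_correction mulmxK// {1}PE addrK.
Qed.

Lemma mass_correction_orthogonal P Q n :
  orthogonal_system u P -> (forall i, msize (Q n i 0) = n.+1) ->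
  P n = Q n + mass_correction_col P n (Q n) ->
  (forall i p, (msize p <= n)%N -> v (Q n i 0 * p) = 0).
Proof.
move=> uP Qsz PE i p pn; rewrite (add_massesM _ uP pn) -mass_correction_colE.
by have := orthogonal_low i uP pn; rewrite {1}PE mxE.
Qed.

(** In [v (Q_i * Q_j)] the second factor may be replaced by [P_j], their difference having degree
    below [n]. In the [u] part of the result, [Q_i] may likewise become [P_i]; the mass part keeps
    [Q_i], whose values give the inverse matrix. *)
Lemma gram_mass_correction P Q n :
  orthogonal_system u P -> perturbation_mx xi lam u P n \in unitmx ->
  P n = Q n + mass_correction_col P n (Q n) ->
  gram v Q n = modified_gram xi lam u P n.
Proof.
move=> uP Munit PE; have [PS _ _] := uP.
have PEi i : P n i 0 = Q n i 0 + mass_correction P n (Q n i 0).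
  by rewrite {1}PE mxE mass_correction_colE.
apply/matrixP => i j; rewrite momentmx_mul_tr.
have -> : v (Q n i 0 * Q n j 0) = v (Q n i 0 * P n j 0).
  rewrite [in RHS]PEi mulrDr linearD /=.
  rewrite (add_massesM (n := n) (p := mass_correction P n _) _ uP) ?msize_kernel_comb//.
  by rewrite -PEi (orthogonal_low _ uP) ?msize_kernel_comb// addr0.
rewrite add_massesE mxE momentmx_mul_tr; congr (_ + _).
  rewrite [P n i 0]PEi mulrDl linearD /= -[LHS]addr0; congr (_ + _).
  by rewrite mulrC (orthogonal_low _ uP)// msize_kernel_comb.
rewrite (_ : points_mx xi P n *m invmx _ = eval_points (Q n)); last first.
  by rewrite points_mxE {1}PE eval_points_mass_correction mulmxK.
rewrite mxE; apply: eq_bigr => k _.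
by rewrite mul_mx_diag !mxE mevalM mulrA [lam _ _ * _]mulrC.
Qed.

End PointMasses.

Theorem theorem3p1 (R : realType) (d N : nat) (u : {scalar {mpoly R[d]}})
    (xi : 'I_N -> 'rV[R]_d) (lam : 'rV[R]_N)
    (hu : quasi_definite u) (hxi : injective xi)
    (hlam : forall j, lam 0 j != 0) :
  let v : {scalar {mpoly R[d]}} := add_masses xi lam u in
  (quasi_definite v ->
     (forall P : vecseq R d, orthogonal_system u P ->
        forall n, (1 <= n)%N -> perturbation_mx xi lam u P n \in unitmx) /\
     (forall Q : vecseq R d, orthogonal_system v Q ->
        exists P : vecseq R d,
          [/\ orthogonal_system u P,
              forall n, Q n = modified_system xi lam u P n
            & forall n, gram v Q n = modified_gram xi lam u P n])) /\
  (forall P : vecseq R d, orthogonal_system u P ->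
     (forall n, (1 <= n)%N -> perturbation_mx xi lam u P n \in unitmx) ->
     (forall n, modified_gram xi lam u P n \in unitmx) ->
     orthogonal_system v (modified_system xi lam u P) /\ quasi_definite v).
Proof.
move=> v; split=> [vqd|P uP Munit Gunit].
  split=> [P uP n _|Q vQ]; first exact: perturbation_mx_unit.
  have [P0 uP0] := hu; have [[PS0 _ _] [QS _ _]] := (uP0, vQ).
  (* The relation sought uses the kernels of [P] itself; those of the auxiliary [P0] serve to define
     [P], and [kernel_unique] identifies them once [P] is known to be orthogonal. *)
  pose P : vecseq R d := fun n => Q n + mass_correction_col u xi lam P0 n (Q n).
  have PE n i : P n i 0 = Q n i 0 + mass_correction u xi lam P0 n (Q n i 0).
    by rewrite mxE mass_correction_colE.
  have uP : orthogonal_system u P.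
    apply: (orthogonal_system_of_low hu) => [|n i p pn].
      apply: (polynomial_system_perturb QS) => n i.
      by rewrite PE addrC addKr msize_kernel_comb.
    by rewrite PE -(add_massesM _ _ _ uP0 pn) (orthogonal_low _ vQ).
  have PEP n : P n = Q n + mass_correction_col u xi lam P n (Q n).
    apply/colP => i; rewrite PE mxE mass_correction_colE; congr (_ + _).
    by apply: eq_bigr => j _; rewrite (kernel_unique _ _ uP0 uP).
  have Munit n := perturbation_mx_unit n vqd uP.
  exists P; split=> // n.
    by apply/modified_system_fixpoint.
  exact: gram_mass_correction.
set Q := modified_system xi lam u P.
(* Index 0 stands for the kernel of index -1, which is zero, so the matrix there is the identity. *)
have {}Munit n : perturbation_mx xi lam u P n \in unitmx.
  by case: n => [|n]; [rewrite perturbation_mx0 unitmx1 | exact: Munit].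
have [PS _ _] := uP.
have PE n : P n = Q n + mass_correction_col u xi lam P n (Q n).
  by apply/modified_system_fixpoint.
have QS : polynomial_system Q.
  apply: (polynomial_system_perturb PS) => n i.
  rewrite [P n]PE [in X in _ - X]mxE mass_correction_colE opprD addNKr.
  by rewrite msizeN msize_kernel_comb.
have [Qsz _ _] := QS.
suff vQ : orthogonal_system v Q by split=> //; exists Q.
split=> // [m n mn|n]; last by rewrite (gram_mass_correction uP).
apply/matrixP => i j; rewrite momentmx_mul_tr mxE.
have [lt_mn|lt_nm|//] := ltngtP m n.
  by rewrite mulrC (mass_correction_orthogonal uP) ?Qsz.
by rewrite (mass_correction_orthogonal uP) ?Qsz.
Qed.
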